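(* Let $f:{}^*\mathbb{R}\to{}^*\mathbb{R}$ be an internal function and let $a\in\mathbb{R}$. If $f$ is twice mu-differentiable (with mu-derivatives $f'$, $f''$), $f'(a)\approx 0$ and $f''(a)\gg 0$, then $a$ is a local m-minimizer of $f$.
   Context: Setting: nonstandard analysis; ${}^*\mathbb{R}$ is the field of hyperreals (a nonstandard extension of $\mathbb{R}$ satisfying the Transfer Principle), with the usual notion of internal sets and functions. ${}^*]b,c[$ denotes the nonstandard extension of the open interval $]b,c[$. For $x,y\in{}^*\mathbb{R}$: $x\approx 0$ ($x$ is infinitesimal) means $|x|<r$ for all real $r>0$; $x\approx y$ means $x-y\approx 0$; $x$ is finite if $|x|<r$ for some real $r>0$; $x$ is nearstandard, $x\in ns({}^*\mathbb{R})$, if $x\approx b$ for some (unique) $b\in\mathbb{R}$. We write $x\gtrsim y$ if $x\ge y$ or $x\approx y$, and $x\gg y$ if $x>y$ and $x\not\approx y$. Mu-differentiability: an internal function $f:{}^*\mathbb{R}\to{}^*\mathbb{R}$ is mu-differentiable if $f(ns({}^*\mathbb{R}))\subseteq ns({}^*\mathbb{R})$ and there is an internal function $f':{}^*\mathbb{R}\to{}^*\mathbb{R}$ (a mu-derivative of $f$, in general not unique) such that (1) $f'(x)$ is finite whenever $x$ is nearstandard; (2) for each $b\in\mathbb{R}$ there is a positive infinitesimal $\delta_b$ such that for all $x,y\approx b$ with $|x-y|>\delta_b$ there is an infinitesimal $\eta$ with $f(x)-f(y)=f'(x)(x-y)+|x-y|\eta$. The function $f$ is twice mu-differentiable if $f$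 is mu-differentiable with a mu-derivative $f'$ which is itself mu-differentiable; $f''$ denotes a mu-derivative of $f'$. A point $a\in\mathbb{R}$ is a local m-minimizer of $f$ if there is a real $r>0$ such that $f(x)\gtrsim f(a)$ for all $x\in{}^*]a-r,a+r[$. *)

(* Defs.v *)
From mathcomp Require Import all_boot all_order all_algebra.
From mathcomp Require Import all_classical all_reals.

Set Implicit Arguments.
Unset Strict Implicit.
Unset Printing Implicit Defensive.

Import Order.TTheory GRing.Theory Num.Theory.
Local Open Scope classical_set_scope.
Local Open Scope ring_scope.

(* The superstructure over a set X of individuals is presented by its typed
   layers: individuals, pairs, and subsets of a layer. *)
Inductive sort : Type :=
| Indiv
| Pow of sort
| Prod of sort & sort.

Fixpoint univ (X : Type) (s : sort) : Type :=
  match s with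
  | Indiv => X
  | Pow t => set (univ X t)
  | Prod t u => (univ X t * univ X u)%type
  end.

(* Bounded-quantifier formulas of the language of the superstructure over K,
   with a constant for each of its entities.  Variables are typed de Bruijn
   indices: a context lists the sorts of the free variables. *)
Inductive var : seq sort -> sort -> Type :=
| VZ G s : var (s :: G) s
| VS G s t : var G s -> var (t :: G) s.

Inductive term (K : Type) (G : seq sort) : sort -> Type :=
| Var s of var G s : term K G s
| Cst s of univ K s : term K G s
| Pair s t of term K G s & term K G t : term K G (Prod s t).

Inductive form (K : Type) (G : seq sort) : Type :=
| Eq s of term K G s & term K G s
| In s of term K G s & term K G (Pow s)
| Neg of form K G
| And of form K G & form K G
| All s of term K G (Pow s) & form K (s :: G).

Fixpoint env (X : Type) (G : seq sort) : Type :=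
  match G with
  | [::] => unit
  | s :: G' => (univ X s * env X G')%type
  end.

Fixpoint lookup (X : Type) (G : seq sort) (s : sort) (v : var G s) :
    env X G -> univ X s :=
  match v in var G s return env X G -> univ X s with
  | VZ _ _ => fun e => e.1
  | VS _ _ _ w => fun e => lookup w e.2
  end.

Section Satisfaction.
Variables (K X : Type) (cst : forall s, univ K s -> univ X s).

Fixpoint eval (G : seq sort) (e : env X G) (s : sort) (a : term K G s) :
    univ X s :=
  match a in term _ _ s return univ X s with
  | Var _ v => lookup v e
  | Cst _ c => cst c
  | Pair _ _ b c => (eval e b, eval e c)
  end.

(* The quantifier [All A p] ranges over all actual members of the value
   of A, whether or not they are internal. *)
Fixpoint sat (G : seq sort) (p : form K G) : env X G -> Prop :=
  match p with
  | Eq _ a b => fun e => eval e a = eval e b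
  | In _ a A => fun e => eval e A (eval e a)
  | Neg q => fun e => ~ sat q e
  | And q r => fun e => sat q e /\ sat r e
  | All _ A q => fun e => forall x, eval e A x -> sat q (x, e)
  end.

End Satisfaction.

(* H is a field of hyperreals over R: [star] maps each entity c of the
   superstructure over R to its nonstandard extension *c in the superstructure
   over H, truth of sentences is preserved (Transfer Principle), *R is H with
   *+, *x and *<= its ordered field structure, and the extension is proper. *)
Record nonstandard_extension (R : realType) (H : realFieldType) : Type :=
  NonstandardExtension {
  star : forall s, univ R s -> univ H s;
  transfer : forall p : form R [::],
    sat (fun s (c : univ R s) => c) p tt <-> sat star p tt;
  star_setT : star (s := Pow Indiv) [set: R] = [set: H];
  star_add :
    star (s := Pow (Prod (Prod Indiv Indiv) Indiv))
      [set z : R * R * R | z.1.1 + z.1.2 = z.2] =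
    [set z : H * H * H | z.1.1 + z.1.2 = z.2];
  star_mul :
    star (s := Pow (Prod (Prod Indiv Indiv) Indiv))
      [set z : R * R * R | z.1.1 * z.1.2 = z.2] =
    [set z : H * H * H | z.1.1 * z.1.2 = z.2];
  star_le :
    star (s := Pow (Prod Indiv Indiv)) [set z : R * R | z.1 <= z.2] =
    [set z : H * H | z.1 <= z.2];
  star_proper : exists x : H, forall r : R, x <> star (s := Indiv) r
}.

Section Nonstandard.
Variables (R : realType) (H : realFieldType).
Variable E : nonstandard_extension R H.

Definition hyper (r : R) : H := star E (s := Indiv) r.

Definition star_set (A : set R) : set H := star E (s := Pow Indiv) A.

(* An entity is internal when it is an element of some *A, equivalently of
   the extension of a whole layer. *)
Definition internal (s : sort) (x : univ H s) : Prop :=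
  exists A : univ R (Pow s), star E A x.

Definition internal_fun (f : H -> H) : Prop :=
  internal (s := Pow (Prod Indiv Indiv)) [set z : H * H | f z.1 = z.2].

Definition infinitesimal (x : H) : Prop :=
  forall r : R, 0 < r -> `|x| < hyper r.

Definition approx (x y : H) : Prop := infinitesimal (x - y).

Definition finite_hyper (x : H) : Prop := exists2 r : R, 0 < r & `|x| < hyper r.

Definition nearstandard (x : H) : Prop := exists b : R, approx x (hyper b).

Definition gtrsim (x y : H) : Prop := x >= y \/ approx x y.

Definition much_gt (x y : H) : Prop := x > y /\ ~ approx x y.

Definition mu_derivative (f f' : H -> H) : Prop :=
  [/\ internal_fun f',
      forall x, nearstandard x -> finite_hyper (f' x) &
      forall b : R, exists delta : H,
        [/\ 0 < delta, infinitesimal delta &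
            forall x y, approx x (hyper b) -> approx y (hyper b) ->
              `|x - y| > delta ->
              exists2 eta : H, infinitesimal eta &
                f x - f y = f' x * (x - y) + `|x - y| * eta]].

Definition mu_differentiable (f : H -> H) : Prop :=
  [/\ internal_fun f,
      forall x, nearstandard x -> nearstandard (f x) &
      exists f' : H -> H, mu_derivative f f'].

(* Twice mu-differentiability of f with a given choice of the (non-unique)
   mu-derivatives f' of f and f'' of f'. *)
Definition twice_mu_differentiable_with (f f' f'' : H -> H) : Prop :=
  [/\ mu_differentiable f, mu_derivative f f',
      mu_differentiable f' & mu_derivative f' f''].

Definition local_m_minimizer (f : H -> H) (a : R) : Prop :=
  exists2 r : R, 0 < r &
    forall x, star_set [set` `]a - r, a + r[] x -> gtrsim (f x) (f (hyper a)).

End Nonstandard.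

(* Main.v *)
Require Import Defs.
From mathcomp Require Import all_boot all_order all_algebra.
From mathcomp Require Import all_classical all_reals.
From mathcomp Require Import ring lra.
Import Defs.

Set Implicit Arguments.
Unset Strict Implicit.
Unset Printing Implicit Defensive.

Import Order.TTheory GRing.Theory Num.Theory.
Local Open Scope classical_set_scope.
Local Open Scope ring_scope.

(* Let [sg = 1] or [sg = -1].  Since [f' a ~ 0] and [f'' a] is bounded below by
   a positive real, [sg * f' (a + sg * k) > sg * f' a] for every infinitesimal
   [k] above some fixed infinitesimal; the internal set of the [k] violating
   this has an infimum, which cannot be infinitesimal, so
   [sg * f' (a + sg * k)] is nonnegative up to an infinitesimal for all [k] in
   a real interval [0, r].  Then, for each real [e > 0],
   [f (a + sg * k) > f a - e * k - e] on [0, r / 2]: otherwise let [t] be the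
   infimum of the violating [k], let [b] be the standard part of [a + sg * t],
   choose a violating [s] just above [t] and step back by [2 * delta_b]; the
   point [s - 2 * delta_b] is not violating, whereas the increment of [f]
   between the two points is at least [- e * 2 * delta_b], a contradiction.
   Internality of the two sets and existence of infima come from Transfer. *)

(** * Derived connectives of the bounded language *)

Definition Imp (K : Type) (G : seq sort) (p q : form K G) : form K G :=
  Neg (And p (Neg q)).

Definition Exs (K : Type) (G : seq sort) (s : sort) (A : term K G (Pow s))
    (p : form K (s :: G)) : form K G :=
  Neg (All A (Neg p)).

Section SatDerived.
Variables (K X : Type) (cst : forall s, univ K s -> univ X s).

Lemma sat_Imp (G : seq sort) (p q : form K G) (e : env X G) :
  sat cst (Imp p q) e = (sat cst p e -> sat cst q e).
Proof.
rewrite propeqE /=; split=> [npq hp|pq [hp]]; last by apply; apply: pq.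
by apply: contrapT => hq; apply: npq.
Qed.

Lemma sat_All (G : seq sort) (s : sort) (A : term K G (Pow s))
    (p : form K (s :: G)) (e : env X G) :
  sat cst (All A p) e = forall x, eval cst e A x -> sat cst p (x, e).
Proof. by []. Qed.

Lemma sat_And (G : seq sort) (p q : form K G) (e : env X G) :
  sat cst (And p q) e = (sat cst p e /\ sat cst q e).
Proof. by []. Qed.

Lemma sat_Exs (G : seq sort) (s : sort) (A : term K G (Pow s))
    (p : form K (s :: G)) (e : env X G) :
  sat cst (Exs A p) e = exists2 x, eval cst e A x & sat cst p (x, e).
Proof.
rewrite propeqE /=; split=> [nall|[x Ax px] nall]; last exact: (nall x Ax px).
by apply: contrapT => nex; apply: nall => x Ax px; apply: nex; exists x.
Qed.

End SatDerived.

Local Notation v0 := (VZ _ _).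
Local Notation v1 := (VS _ v0).
Local Notation v2 := (VS _ v1).
Local Notation v3 := (VS _ v2).
Local Notation v4 := (VS _ v3).
Local Notation v5 := (VS _ v4).
Local Notation v6 := (VS _ v5).
Local Notation v7 := (VS _ v6).
Local Notation v8 := (VS _ v7).
Local Notation v9 := (VS _ v8).
Local Notation v10 := (VS _ v9).
Local Notation v11 := (VS _ v10).
Local Notation v12 := (VS _ v11).
Local Notation v13 := (VS _ v12).
Local Notation "'#' v" := (Var _ v) (at level 0, v at level 0).

(** * Transfer of the ordered field structure *)

Section Hyperreals.
Variables (R : realType) (H : realFieldType) (E : nonstandard_extension R H).

Local Notation h := (hyper E).
Local Notation true_in_R p := (@sat R R (fun s c => c) [::] p tt).
Local Notation RAdd :=
  [set z : univ R (Prod (Prod Indiv Indiv) Indiv) | z.1.1 + z.1.2 = z.2 :> R].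
Local Notation RMul :=
  [set z : univ R (Prod (Prod Indiv Indiv) Indiv) | z.1.1 * z.1.2 = z.2 :> R].
Local Notation RLe :=
  [set z : univ R (Prod Indiv Indiv) | (z.1 : R) <= z.2].
Local Notation Reals := (@Cst R _ (Pow Indiv) [set: R]).

(** The language has no function symbols, so arithmetic enters through the graphs whose extensions
    [star_add], [star_mul] and [star_le] identify. *)
Definition Add G (t u v : term R G Indiv) : form R G :=
  In (Pair (Pair t u) v) (Cst (s := Pow (Prod (Prod Indiv Indiv) Indiv)) _ RAdd).
Definition Mul G (t u v : term R G Indiv) : form R G :=
  In (Pair (Pair t u) v) (Cst (s := Pow (Prod (Prod Indiv Indiv) Indiv)) _ RMul).
Definition Le G (t u : term R G Indiv) : form R G :=
  In (Pair t u) (Cst (s := Pow (Prod Indiv Indiv)) _ RLe).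

Lemma sat_Add G (t u v : term R G Indiv) e :
  sat (star E) (Add t u v) e =
  (eval (star E) e t + eval (star E) e u = eval (star E) e v :> H).
Proof. by rewrite /= (star_add E). Qed.

Lemma sat_Mul G (t u v : term R G Indiv) e :
  sat (star E) (Mul t u v) e =
  (eval (star E) e t * eval (star E) e u = eval (star E) e v :> H).
Proof. by rewrite /= (star_mul E). Qed.

Lemma sat_Le G (t u : term R G Indiv) e :
  sat (star E) (Le t u) e =
  ((eval (star E) e t : H) <= eval (star E) e u).
Proof. by rewrite /= (star_le E). Qed.

Lemma star_sat p : true_in_R p -> sat (star E) p tt.
Proof. by move/(transfer E p). Qed.

Lemma hyperD (x y : R) : h (x + y) = h x + h y.
Proof.
have := (transfer E (Add (Cst (s:=Indiv) _ x) (Cst (s:=Indiv) _ y)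
  (Cst (s:=Indiv) _ (x + y)))).1.
by rewrite sat_Add => /(_ erefl).
Qed.

Lemma hyperM (x y : R) : h (x * y) = h x * h y.
Proof.
have := (transfer E (Mul (Cst (s:=Indiv) _ x) (Cst (s:=Indiv) _ y)
  (Cst (s:=Indiv) _ (x * y)))).1.
by rewrite sat_Mul => /(_ erefl).
Qed.

Lemma ler_hyper (x y : R) : (h x <= h y) = (x <= y).
Proof.
have := transfer E (Le (Cst (s:=Indiv) _ x) (Cst (s:=Indiv) _ y)).
by rewrite sat_Le /= => -[lr rl]; apply/idP/idP.
Qed.

Lemma ltr_hyper (x y : R) : (h x < h y) = (x < y).
Proof. by rewrite !ltNge ler_hyper. Qed.

Lemma hyper0 : h 0 = 0.
Proof. by apply: (addrI (h 0)); rewrite -hyperD !addr0. Qed.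

Lemma hyperN (x : R) : h (- x) = - h x.
Proof. by apply: (addrI (h x)); rewrite -hyperD !subrr hyper0. Qed.

Lemma hyperB (x y : R) : h (x - y) = h x - h y.
Proof. by rewrite hyperD hyperN. Qed.

Lemma hyper_gt0 (x : R) : (0 < h x) = (0 < x).
Proof. by rewrite -hyper0 ltr_hyper. Qed.

(** * Transfer for intervals and internal sets *)

Lemma star_set_itv_bounds (a b : R) (x : H) :
  star_set E [set` `]a, b[] x -> h a <= x <= h b.
Proof.
move=> xab.
have /star_sat : true_in_R (All (Cst (s := Pow Indiv) _ ([set` `]a, b[] : set R))
  (And (Le (Cst (s:=Indiv) _ a) #v0) (Le #v0 (Cst (s:=Indiv) _ b)))) .
  move=> y /=.
  by rewrite in_itv /= => /andP[ay yb]; split; exact: ltW.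
move=> /(_ x xab); rewrite /= (star_le E) => -[ax xb].
by rewrite ax.
Qed.

(** Internality puts [S] in the extension of some family [A] of sets of reals. Completeness of [R],
    stated for all members of [A], transfers to all members of that extension. *)
Lemma internal_glb (S : set H) (c k0 : H) :
  internal E (s := Pow Indiv) S -> (forall k, S k -> c <= k) -> S k0 ->
  exists2 t, (forall k, S k -> t <= k) &
             forall u, (forall k, S k -> u <= k) -> u <= t.
Proof.
case=> A AS cS Sk0.
have /star_sat : true_in_R (All (Cst (s := Pow (Pow Indiv)) _ A)
  (All Reals
  (Imp (All #v1 (Le #v1 #v0))
  (Imp (Exs #v1 (Eq #v0 #v0))
  (Exs Reals (And (All #v2 (Le #v1 #v0))
    (All Reals (Imp (All #v3 (Le #v1 #v0))
                    (Le #v0 #v1))))))))) .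
  rewrite sat_All => T AT; rewrite sat_All => b _.
  rewrite !sat_Imp !sat_Exs => /= bT [x Tx _].
  have hT : has_inf T by split; [exists x | exists b => y /bT].
  exists (inf T) => //; split=> [y Ty|u _]; first exact: ge_inf hT.2 _ Ty.
  by case=> uT; apply; apply: lb_le_inf hT.1 _ => y /uT.
rewrite sat_All => /(_ S AS); rewrite sat_All => /(_ c).
rewrite [eval _ _ _]/= (star_setT E) => /(_ I).
rewrite !sat_Imp !sat_Exs /= (star_le E) (star_setT E) => /(_ cS).
case=> [|t _ [tS tglb]]; first by exists k0.
exists t => // u uS; apply: contrapT => nut.
by apply: (tglb u).
Qed.

Fixpoint internal_env (G : seq sort) : env H G -> Prop :=
  match G with
  | [::] => fun=> True
  | s :: G' => fun e => internal E e.1 /\ internal_env e.2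
  end.

(** Transfer with internal parameters: each parameter lies in some extension, so its variable can be
    bound by a universal quantifier over the corresponding standard set, one at a time. *)
Lemma star_sat_env (G : seq sort) (p : form R G) :
  (forall e : env R G, sat (fun s (c : univ R s) => c) p e) ->
  forall e : env H G, internal_env e -> sat (star E) p e.
Proof.
elim: G p => [|s G IH] p pR /=; first by case=> _; apply: star_sat.
case=> x e [[A Ax] ie].
by apply: (IH (All (Cst (s := Pow s) _ A) p)) => // e' y _; apply: pR.
Qed.

Lemma internal_indiv (x : H) : internal E (s := Indiv) x.
Proof. by exists [set: R]; rewrite (star_setT E). Qed.

(** An instance of the internal definition principle, obtained by transferring comprehension for one
    formula. The shape covers both violating sets used below: [tau = sg], [m = 0] for [f'], and
    [tau = 1], [m = - h e] for [f]. *)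
Lemma internal_affine_sublevel (f : H -> H) (sg x tau m w c : H) :
  internal_fun E f ->
  internal E (s := Pow Indiv)
    [set k | c <= k /\ tau * f (x + sg * k) <= m * k + w].
Proof.
move=> intf.
pose G := [:: Pow (Prod Indiv Indiv); Indiv; Indiv; Indiv; Indiv; Indiv; Indiv].
(* The variables, from index 0: [k], the set to be defined, the graph of [f], [sg], [x], [tau], [m],
   [w], [c]. Each intermediate value is named by an existential quantifier. *)
pose phi : form R (Indiv :: Pow Indiv :: G) := And (Le #v8 #v0)
  (Exs Reals (And (Mul #v4 #v1 #v0)
  (Exs Reals (And (Add #v6 #v1 #v0)
  (Exs Reals (And (In (Pair #v1 #v0) #v5)
  (Exs Reals (And (Mul #v9 #v1 #v0)
  (Exs Reals (And (Mul #v11 #v5 #v0)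
  (Exs Reals (And (Add #v1 #v13 #v0) (Le #v2 #v0))))))))))))).
pose comprehension : form R G := Exs (Cst (s := Pow (Pow Indiv)) _ setT)
  (All Reals (And (Imp (In #v0 #v1) phi) (Imp phi (In #v0 #v1)))).
pose e : env H G := ([set z | f z.1 = z.2], (sg, (x, (tau, (m, (w, (c, tt))))))).
have /star_sat_env : forall e : env R G,
    sat (fun s (c : univ R s) => c) comprehension e.
  move=> e'; rewrite /comprehension sat_Exs.
  (* [phi] does not mention the set being defined, so [set0] can fill its slot. *)
  exists [set k : R | sat (fun s (c : univ R s) => c) phi (k, (set0, e'))] => //.
  by rewrite sat_All => k _; rewrite sat_And !sat_Imp.
move=> /(_ e); rewrite /comprehension sat_Exs => -[|K intK].
  by do 7![split; first exact: internal_indiv || exact: intf].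
rewrite sat_All [eval _ _ _]/= (star_setT E) => Kphi.
suff -> : [set k | c <= k /\ tau * f (x + sg * k) <= m * k + w] = K by exists setT.
apply/seteqP; split=> k.
  move=> /= [ck fk]; have := Kphi k I; rewrite sat_And !sat_Imp => -[_]; apply.
  rewrite /phi sat_And sat_Le; split=> //.
  rewrite sat_Exs; exists (sg * k); first by rewrite /= (star_setT E).
  rewrite sat_And sat_Mul; split=> //.
  rewrite sat_Exs; exists (x + sg * k); first by rewrite /= (star_setT E).
  rewrite sat_And sat_Add; split=> //.
  rewrite sat_Exs; exists (f (x + sg * k)); first by rewrite /= (star_setT E).
  rewrite sat_And; split=> //.
  rewrite sat_Exs; exists (tau * f (x + sg * k)); first by rewrite /= (star_setT E).
  rewrite sat_And sat_Mul; split=> //.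
  rewrite sat_Exs; exists (m * k); first by rewrite /= (star_setT E).
  rewrite sat_And sat_Mul; split=> //.
  rewrite sat_Exs; exists (m * k + w); first by rewrite /= (star_setT E).
  by rewrite sat_And sat_Add sat_Le.
move=> Kk; have := Kphi k I; rewrite sat_And !sat_Imp => -[/(_ Kk) + _].
rewrite /phi sat_And sat_Le sat_Exs => -[ck [p _]].
rewrite sat_And sat_Mul sat_Exs => -[Ep [y _]].
rewrite sat_And sat_Add sat_Exs => -[Ey [z _]].
rewrite sat_And sat_Exs => -[Ez [q _]].
rewrite sat_And sat_Mul sat_Exs => -[Eq [q' _]].
rewrite sat_And sat_Mul sat_Exs => -[Eq' [q'' _]].
rewrite sat_And sat_Add sat_Le => -[Eq'' le_q].
by move: ck Ep Ey Ez Eq Eq' Eq'' le_q => /= ck <- <- <- <- <- <-.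
Qed.

(** * Infinitesimals, standard parts and continuity *)

Local Notation inft := (infinitesimal E).
Local Notation "x ~~ y" := (approx E x y) (at level 70).

Lemma infinitesimal0 : inft 0.
Proof. by move=> r r0; rewrite normr0 hyper_gt0. Qed.

Lemma infinitesimalN x : inft x -> inft (- x).
Proof. by move=> ix r r0; rewrite normrN; exact: ix. Qed.

Lemma infinitesimalD x y : inft x -> inft y -> inft (x + y).
Proof.
move=> ix iy r r0; have r2 : 0 < r / 2 by lra.
have -> : r = r / 2 + r / 2 by lra.
rewrite hyperD (le_lt_trans (ler_normD x y))// ltrD//; [exact: ix|exact: iy].
Qed.

Lemma le_infinitesimal x y : `|x| <= `|y| -> inft y -> inft x.
Proof. by move=> xy iy r r0; apply: (le_lt_trans xy); exact: iy. Qed.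

Lemma infinitesimalM x y : finite_hyper E x -> inft y -> inft (x * y).
Proof.
case=> s s0 xs iy r r0; have rs : 0 < r / s by rewrite divr_gt0.
have -> : r = s * (r / s) by rewrite mulrC divfK// gt_eqF.
by rewrite normrM hyperM; apply: ltr_pM; rewrite ?normr_ge0//; exact: iy.
Qed.

Lemma infinitesimal_finite x : inft x -> finite_hyper E x.
Proof. by move=> ix; exists 1 => //; exact: ix. Qed.

Lemma approx_refl x : x ~~ x.
Proof. by rewrite /approx subrr; exact: infinitesimal0. Qed.

Lemma approx_sym x y : x ~~ y -> y ~~ x.
Proof. by move=> /infinitesimalN; rewrite opprB. Qed.

Lemma approx_trans y x z : x ~~ y -> y ~~ z -> x ~~ z.
Proof.
move=> xy yz; rewrite /approx (_ : x - z = (x - y) + (y - z)); last by ring.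
exact: infinitesimalD.
Qed.

Lemma approx_addr x y d : x ~~ y -> inft d -> x + d ~~ y.
Proof.
by move=> xy id; rewrite /approx addrAC; exact: infinitesimalD.
Qed.

Lemma not_infinitesimal x : ~ inft x -> exists2 r : R, 0 < r & h r <= `|x|.
Proof.
move=> nix; apply: contrapT => nr; apply: nix => r r0.
by rewrite ltNge; apply/negP => rx; apply: nr; exists r.
Qed.

(** The standard part is the supremum of the reals below [x]. *)
Lemma finite_nearstandard x : finite_hyper E x -> nearstandard E x.
Proof.
case=> r r0; rewrite ltr_norml -hyperN => /andP[rx xr].
pose A := [set q : R | h q <= x].
have supA : has_sup A.
  split; first by exists (- r); exact: ltW.
  by exists r => q qx; rewrite -ler_hyper (le_trans qx)// ltW.
exists (sup A) => e e0; rewrite ltr_norml; apply/andP; split.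
  have [q Aq] := sup_adherent e0 supA.
  by rewrite -ltr_hyper hyperB /A /= in Aq * => qA; lra.
suff : x < h (sup A + e) by rewrite hyperD; lra.
rewrite ltNge; apply/negP => xA.
have := sup_upper_bound supA xA; lra.
Qed.

Lemma ge_infinitesimal_gtrsim x y :
  (forall e : R, 0 < e -> y - h e <= x) -> gtrsim E x y.
Proof.
move=> yx; have [?|xy] := leP y x; [by left|right => r r0].
rewrite ltr0_norm ?subr_lt0// opprB.
have r2 : 0 < r / 2 by lra.
have := yx _ r2; have : h (r / 2) < h r by rewrite ltr_hyper; lra.
lra.
Qed.

(** Beyond distance [d] the increment is infinitesimal because [f'] is finite. Closer points are
    both compared with [x + 3d], which is at distance at least [2d] from each. *)
Lemma mu_derivative_approx f f' (b : R) x y :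
  mu_derivative E f f' -> x ~~ h b -> y ~~ h b -> f x ~~ f y.
Proof.
move=> [_ finf' /(_ b)[d [d0 id df]]].
have far u v : u ~~ h b -> v ~~ h b -> d < `|u - v| -> f u ~~ f v.
  move=> ub vb uv; have [eta ieta E1] := df u v ub vb uv.
  have iuv : inft (u - v) by exact: approx_trans ub (approx_sym vb).
  rewrite /approx E1; apply: infinitesimalD.
    by apply: infinitesimalM => //; apply: finf'; exists b.
  apply: infinitesimalM ieta.
  by apply: infinitesimal_finite; apply: le_infinitesimal iuv; rewrite normr_id.
move=> xb yb; have [xy|xy] := ltP d `|x - y|; first exact: far.
have zb : x + (d + d + d) ~~ h b.
  by apply: approx_addr => //; do !apply: infinitesimalD.
apply: (approx_trans (far _ _ xb zb _)).
  by rewrite opprD addNKr normrN gtr0_norm; lra.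
apply: far => //; apply: lt_le_trans (ler_norm _).
by move: xy; rewrite ler_norml => /andP[]; lra.
Qed.

(** * The test on one side of [a], in the direction [sg] *)

Section SecondDerivativeTest.
Variables (f f' f'' : H -> H) (a : R) (sg : H).
Hypotheses (intf : internal_fun E f) (intf' : internal_fun E f').
Hypotheses (df : mu_derivative E f f') (df' : mu_derivative E f' f'').
Hypotheses (f'a : f' (h a) ~~ 0) (sgE : sg = 1 \/ sg = - 1).

Let normsg : `|sg| = 1.
Proof. by case: sgE => ->; rewrite ?normrN normr1. Qed.

Let sgsg : sg * sg = 1.
Proof. by case: sgE => ->; rewrite ?mulrNN mulr1. Qed.

Let infsg k : inft k -> inft (sg * k).
Proof. by apply: le_infinitesimal; rewrite normrM normsg mul1r. Qed.

Let near k : inft k -> h a + sg * k ~~ h a.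
Proof. by move=> ik; apply: approx_addr (approx_refl _) (infsg ik). Qed.

Lemma derivative_sign_near (c : R) : 0 < c -> h c <= f'' (h a) ->
  exists2 r : R, 0 < r & forall k, 0 <= k -> k <= h r ->
    forall e : R, 0 < e -> - h e <= sg * f' (h a + sg * k).
Proof.
move=> c0 cf''.
have [_ _ /(_ a)[d [d0 id dfa]]] := df'.
(* The increment of [sg * f'] is [k * (f'' (h a) - sg * eta)], positive since [f'' (h a)] is at
   least the real [c]. *)
have good k : d < k -> inft k -> sg * f' (h a) < sg * f' (h a + sg * k).
  move=> dk ik; have k0 : 0 < k by exact: lt_trans dk.
  have nk : h a - (h a + sg * k) = - (sg * k) by ring.
  have nk' : `|h a - (h a + sg * k)| = k.
    by rewrite nk normrN normrM normsg mul1r gtr0_norm.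
  have [|eta ieta] := dfa (h a) (h a + sg * k) (approx_refl _) (near ik).
    by rewrite nk'.
  rewrite nk' nk => E1; rewrite -subr_lt0 -mulrBr E1.
  have -> : sg * (f'' (h a) * - (sg * k) + k * eta) =
            k * (sg * eta - (sg * sg) * f'' (h a)) by ring.
  rewrite sgsg mul1r pmulr_rlt0// subr_lt0 (lt_le_trans _ cf'')//.
  exact: le_lt_trans (ler_norm _) (infsg ieta c0).
(* The cutoff [d + d] leaves out the [k] too small for [good]. *)
pose bad := [set k | d + d <= k /\ sg * f' (h a + sg * k) <= 0 * k + sg * f' (h a)].
have intbad : internal E (s := Pow Indiv) bad by exact: internal_affine_sublevel.
have [r r0 rbad] : exists2 r : R, 0 < r & forall k, bad k -> h r < k.
  have [nbad|/existsNP[k0 /contrapT bk0]] := pselect (forall k, ~ bad k).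
    by exists 1 => // k /nbad.
  have [t tlb tglb] : exists2 t, (forall k, bad k -> t <= k) &
      forall u, (forall k, bad k -> u <= k) -> u <= t.
    by apply: (internal_glb intbad (c := d + d) _ bk0) => k [].
  have dt : d + d <= t by apply: tglb => k [].
  (* The infimum need not be attained; a violating point within [d] of it is infinitesimal as soon
     as [t] is. *)
  have [s bads st] : exists2 s, bad s & s < t + d.
    apply: contrapT => ns.
    suff : t + d <= t by lra.
    apply: tglb => k bk; rewrite leNgt; apply/negP => kt.
    by apply: ns; exists k.
  have nit : ~ inft t.
    move=> it; have is_ : inft s.
      apply: le_infinitesimal (infinitesimalD it id).
      by have ts := tlb _ bads; rewrite !ger0_norm; lra.
    case: bads => ds; rewrite mul0r add0r leNgt => /negP; apply.
    by apply: good => //; lra.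
  have [r r0 rt] := not_infinitesimal nit.
  have rr : h (r / 2) < h r by rewrite ltr_hyper; lra.
  exists (r / 2); first lra.
  move=> k bk; rewrite ger0_norm in rt; last lra.
  by have := tlb _ bk; lra.
exists r => // k k0 kr e e0.
have [kd|dk] := ltP k (d + d).
  have ik : inft k.
    apply: le_infinitesimal (infinitesimalD id id).
    by rewrite !ger0_norm; lra.
  have : f' (h a + sg * k) ~~ 0.
    exact: approx_trans (mu_derivative_approx df' (near ik) (approx_refl _)) f'a.
  rewrite /approx subr0 => /infsg /(_ e e0); rewrite ltr_norml => /andP[]; lra.
have [bk|bk] := leP (sg * f' (h a + sg * k)) (0 * k + sg * f' (h a)).
  have : bad k by [].
  by move=> /rbad; lra.
move: f'a; rewrite /approx subr0 => /infsg /(_ e e0); rewrite ltr_norml => /andP[].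
by lra.
Qed.

(** The slope [- h e] absorbs the errors in the increment of [f]. The constant [- h e] keeps
    infinitesimals out of the violating set, so stepping back from [s] stays in [k >= 0]. *)
Lemma almost_minimum_near (r e : R) (k : H) :
  0 < r -> 0 < e -> 0 <= k -> k + k <= h r ->
  (forall k, 0 <= k -> k <= h r ->
    forall e : R, 0 < e -> - h e <= sg * f' (h a + sg * k)) ->
  f (h a) - h e * k - h e <= f (h a + sg * k).
Proof.
move=> r0 e0 k0 kr f'ge; rewrite leNgt; apply/negP => fk.
have he0 : 0 < h e by rewrite hyper_gt0.
pose bad := [set k | 0 <= k /\ 1 * f (h a + sg * k) <= (- h e) * k + (f (h a) - h e)].
have intbad : internal E (s := Pow Indiv) bad by exact: internal_affine_sublevel.
have badk : bad k by split=> //; rewrite mul1r; lra.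
have [t tlb tglb] : exists2 t, (forall k, bad k -> t <= k) &
    forall u, (forall k, bad k -> u <= k) -> u <= t.
  by apply: (internal_glb intbad (c := 0) _ badk) => ? [].
have t0 : 0 <= t by apply: tglb => ? [].
have tk : t <= k by exact: tlb.
(* The scale [d] depends on the standard point, so [b] is taken from [t] before [s] is chosen; [s]
   and [y] then stay infinitely close to [b]. *)
have [b tb] : nearstandard E (h a + sg * t).
  apply: finite_nearstandard; exists (`|a| + r + 1).
    by rewrite addrC ltr_pwDl// addr_ge0// ltW.
  apply: le_lt_trans (ler_normD _ _) _; rewrite normrM normsg mul1r ger0_norm//.
  have ha : `|h a| <= h `|a|.
    by rewrite ler_norml -hyperN !ler_hyper lerNl ler_norm -normrN ler_norm.
  have : 0 < h 1 by rewrite hyper_gt0.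
  by rewrite !hyperD; lra.
have [_ _ /(_ b)[d [d0 id dfb]]] := df.
have [s bads st] : exists2 s, bad s & s < t + d.
  apply: contrapT => ns.
  suff : t + d <= t by lra.
  apply: tglb => u bu; rewrite leNgt; apply/negP => ut.
  by apply: ns; exists u.
have ts := tlb _ bads.
have [s0 fs] := bads; rewrite mul1r in fs.
have [sd|ds] := ltP s (d + d).
  have is_ : inft s.
    apply: le_infinitesimal (infinitesimalD id id).
    by rewrite !ger0_norm; lra.
  have := mu_derivative_approx df (near is_) (approx_refl _).
  move=> /(_ e e0); rewrite ltr_norml => /andP[fse _].
  have : 0 <= h e * s by rewrite mulr_ge0// ltW.
  by lra.
set y := s - (d + d).
have nbady : ~ bad y by move=> /tlb; rewrite /y; lra.
have fy : - h e * y + (f (h a) - h e) < f (h a + sg * y).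
  rewrite ltNge; apply/negP => fy; apply: nbady; split; rewrite ?mul1r//.
  by rewrite /y; lra.
have sb : h a + sg * s ~~ h b.
  have -> : h a + sg * s = (h a + sg * t) + sg * (s - t) by ring.
  apply: approx_addr => //; apply: infsg; apply: le_infinitesimal id.
  by rewrite !ger0_norm; lra.
have yb : h a + sg * y ~~ h b.
  have -> : h a + sg * y = (h a + sg * s) + sg * (- (d + d)) by rewrite /y; ring.
  apply: approx_addr => //; apply: infsg.
  by apply: infinitesimalN; exact: infinitesimalD.
have sy : h a + sg * s - (h a + sg * y) = sg * (d + d) by rewrite /y; ring.
have nsy : `|h a + sg * s - (h a + sg * y)| = d + d.
  by rewrite sy normrM normsg mul1r gtr0_norm; lra.
have [|eta ieta] := dfb _ _ sb yb; first by rewrite nsy; lra.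
rewrite nsy sy => E1.
have e2 : 0 < e / 2 by lra.
have he2 : h e = h (e / 2) + h (e / 2) by rewrite -hyperD; congr h; lra.
(* [s] may exceed [k], but by less than [d]; the assumption [k + k <= h r] leaves room for this. *)
have f's : - h (e / 2) <= sg * f' (h a + sg * s).
  apply: f'ge => //; have r2 : 0 < r / 2 by lra.
  have hr2 : h r = h (r / 2) + h (r / 2) by rewrite -hyperD; congr h; lra.
  by have := id _ r2; rewrite ger0_norm; lra.
move: (ieta _ e2); rewrite ltr_norml => /andP[etae _].
(* The increment from [y] to [s] thus exceeds [- h e * (d + d)], while [bads] and [fy] make it
   smaller. *)
have : 0 < (d + d) * (sg * f' (h a + sg * s) + eta + h e).
  by apply: mulr_gt0; lra.
have Ey : h e * y = h e * s - h e * (d + d) by rewrite /y; ring.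
lra.
Qed.

Lemma one_sided_minimizer (c : R) : 0 < c -> h c <= f'' (h a) ->
  exists2 r : R, 0 < r &
    forall k, 0 <= k -> k <= h r -> gtrsim E (f (h a + sg * k)) (f (h a)).
Proof.
move=> c0 /(derivative_sign_near c0)[r r0 f'ge].
have r2 : 0 < r / 2 by lra.
have hr2 : h r = h (r / 2) + h (r / 2) by rewrite -hyperD; congr h; lra.
exists (r / 2) => // k k0 kr; apply: ge_infinitesimal_gtrsim => e e0.
have r1 : 0 < r + 1 by lra.
(* With this choice the total error [h e1 * k + h e1] is at most [h e1 * (h r + 1) = h e], writing
   [e1] for [e / (r + 1)]. *)
have e1 : 0 < e / (r + 1) by rewrite divr_gt0.
have kr' : k + k <= h r by lra.
apply: le_trans (almost_minimum_near r0 e1 k0 kr' f'ge).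
have he : h e = h (e / (r + 1)) * h r + h (e / (r + 1)).
  by rewrite -hyperM -hyperD -[X in _ + X]mulr1 -mulrDr divfK// gt_eqF.
have : h (e / (r + 1)) * k <= h (e / (r + 1)) * h r.
  by apply: ler_wpM2l; [rewrite ltW// hyper_gt0|lra].
lra.
Qed.
End SecondDerivativeTest.
End Hyperreals.

Theorem mainTheorem3 (R : realType) (H : realFieldType)
    (E : nonstandard_extension R H) (f f' f'' : H -> H) (a : R)
    (hint : internal_fun E f)
    (hf : twice_mu_differentiable_with E f f' f'')
    (h1 : approx E (f' (hyper E a)) 0%R)
    (h2 : much_gt E (f'' (hyper E a)) 0%R) :
  local_m_minimizer E f a.
Proof.
case: hf => _ df [intf' _ _] df'.
case: h2 => f''gt0; rewrite /approx subr0 => /not_infinitesimal[c c0].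
rewrite gtr0_norm// => cf''.
(* [sg = 1] serves the points to the right of [a], [sg = - 1] those to the left. *)
have [r r0 fr] := one_sided_minimizer hint intf' df df' h1 (or_introl erefl) c0 cf''.
have [l l0 fl] := one_sided_minimizer hint intf' df df' h1 (or_intror erefl) c0 cf''.
exists (Num.min r l) => [|x /star_set_itv_bounds]; first by rewrite lt_min r0.
rewrite hyperB hyperD => /andP[lx xr].
have mr : hyper E (Num.min r l) <= hyper E r by rewrite ler_hyper ge_min lexx.
have ml : hyper E (Num.min r l) <= hyper E l by rewrite ler_hyper ge_min lexx orbT.
have [ax|xa] := leP (hyper E a) x.
  by rewrite -(subrK (hyper E a) x) addrC -[x - _]mul1r; apply: fr; lra.
rewrite (_ : x = hyper E a + - 1 * (hyper E a - x)); last by ring.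
by apply: fl; lra.
Qed.
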